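(* Let $Q$ be a quiver, $\alpha\geq1$, let $\mathbf{r}\in\mathbb{N}^{Q_0}$ be an indivisible rank vector and let $\lambda\in\mathbb{Z}^{Q_0}$ be generic with respect to $\mathbf{r}$. Suppose that $\mathbb{F}_q$ has characteristic larger than $\sum_{i\in Q_0}|\lambda_i|\cdot r_i$. Then $$\frac{\sharp_{\mathbb{F}_q}\mu_{Q,\mathbf{r},\alpha}^{-1}(t^{\alpha-1}\cdot\lambda)}{\sharp_{\mathbb{F}_q}\mathrm{GL}(\mathbf{r},\mathcal{O}_\alpha)}=q^{-\alpha\langle\mathbf{r},\mathbf{r}\rangle}\cdot\frac{A_{Q,\mathbf{r},\alpha}(q)}{1-q^{-1}}.$$
   Context: A quiver $Q=(Q_0,Q_1,s,t)$ consists of finite sets of vertices $Q_0$ and arrows $Q_1$ with source and target maps $s,t:Q_1\to Q_0$. Euler form: $\langle \mathbf{d},\mathbf{e}\rangle=\sum_{i\in Q_0}d_ie_i-\sum_{a\in Q_1}d_{s(a)}e_{t(a)}$. Let $\mathcal{O}_\alpha=\mathbb{F}_q[t]/(t^\alpha)$. $\mathbf{r}$ is indivisible if it is nonzero and the gcd of its entries is $1$. $\lambda$ is generic with respect to $\mathbf{r}$ if $\lambda\cdot\mathbf{r}=\sum_i\lambda_ir_i=0$ and $\lambda\cdot\mathbf{r}'\neq0$ (in $\mathbb{Z}$) for all $\mathbf{r}'\in\mathbb{N}^{Q_0}$ with $0<\mathbf{r}'<\mathbf{r}$ (i.e. $\mathbf{r}'\le\mathbf{r}$ componentwise, $\mathbf{r}'\neq0,\mathbf{r}$).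 A locally free representation of $Q$ over $\mathcal{O}_\alpha$ of rank $\mathbf{r}$ is a collection of free $\mathcal{O}_\alpha$-modules $M_i$ of rank $r_i$ and $\mathcal{O}_\alpha$-linear maps $f_a:M_{s(a)}\to M_{t(a)}$. It is indecomposable if it is nonzero and is not a direct sum of two nonzero subrepresentations, and absolutely indecomposable if its base change to $\overline{\mathbb{F}_q}[t]/(t^\alpha)$ is indecomposable. $A_{Q,\mathbf{r},\alpha}(q)$ is the number of isomorphism classes of absolutely indecomposable locally free representations of rank $\mathbf{r}$ over $\mathbb{F}_q[t]/(t^\alpha)$. $\mathrm{GL}(\mathbf{r},\mathcal{O}_\alpha)=\prod_{i}\mathrm{GL}(r_i,\mathcal{O}_\alpha)$. The moment map $\mu_{Q,\mathbf{r},\alpha}$ sends a tuple $(x_a,y_a)_{a\in Q_1}$, with $x_a\in\mathrm{Hom}_{\mathcal{O}_\alpha}(\mathcal{O}_\alpha^{r_{s(a)}},\mathcal{O}_\alpha^{r_{t(a)}})$ and $y_a\in\mathrm{Hom}_{\mathcal{O}_\alpha}(\mathcal{O}_\alpha^{r_{t(a)}},\mathcal{O}_\alpha^{r_{s(a)}})$, to $\big(\sum_{t(a)=i}x_ay_a-\sum_{s(a)=i}y_ax_a\big)_{i\in Q_0}\in\prod_i\mathrm{Mat}_{r_i\times r_i}(\mathcal{O}_\alpha)$, and $t^{\alpha-1}\cdot\lambda$ denotes $(t^{\alpha-1}\lambda_i\,\mathrm{Id}_{r_i})_{i\in Q_0}$. $\sharp_{\mathbb{F}_q}$ denotes the number of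 $\mathbb{F}_q$-points. *)

(* Defs.v *)
From HB Require Import structures.
From mathcomp Require Import all_boot all_order all_algebra.
From mathcomp Require Import boolp.

Set Implicit Arguments.
Unset Strict Implicit.
Unset Printing Implicit Defensive.

Import Order.TTheory GRing.Theory Num.Theory.
Local Open Scope ring_scope.

Record quiver := Quiver {
  vertex : finType;
  arrow : finType;
  src : arrow -> vertex;
  tgt : arrow -> vertex
}.

Definition euler_form (Q : quiver) (d e : vertex Q -> nat) : int :=
  \sum_(i : vertex Q) (d i)%:Z * (e i)%:Z
  - \sum_(a : arrow Q) (d (src a))%:Z * (e (tgt a))%:Z.

Definition indivisible (Q : quiver) (r : vertex Q -> nat) : Prop :=
  (exists i, r i != 0%N) /\ \big[gcdn/0%N]_(i : vertex Q) r i = 1%N.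

Definition pairing (Q : quiver) (lambda : vertex Q -> int)
    (r : vertex Q -> nat) : int :=
  \sum_(i : vertex Q) lambda i * (r i)%:Z.

Definition generic (Q : quiver) (lambda : vertex Q -> int)
    (r : vertex Q -> nat) : Prop :=
  pairing lambda r = 0 /\
  forall r' : vertex Q -> nat,
    (forall i, (r' i <= r i)%N) ->
    (exists i, r' i != 0%N) ->
    (exists i, r' i != r i) ->
    pairing lambda r' != 0.

(* F[t]/(t^alpha).  For alpha = 0 the library quotients by 'X instead of by 1,
   so that this is the intended ring only for alpha >= 1. *)
Definition trunc_poly (F : fieldType) (alpha : nat) :=
  {poly %/ ('X^alpha : {poly F})}.

HB.instance Definition _ (F : fieldType) alpha :=
  GRing.ComUnitRing.on (trunc_poly F alpha).
HB.instance Definition _ (F : finFieldType) alpha :=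
  Finite.copy (trunc_poly F alpha) {poly %/ ('X^alpha : {poly F})}.
HB.instance Definition _ (F : finFieldType) alpha :=
  GRing.ComUnitRing.on (trunc_poly F alpha).

Definition trunc_t (F : fieldType) (alpha : nat) : trunc_poly F alpha :=
  in_qpoly 'X^alpha 'X.

(* The map F[t]/(t^alpha) -> K[t]/(t^alpha) acting by iota on coefficients. *)
Definition trunc_map (F K : fieldType) (iota : {rmorphism F -> K})
    (alpha : nat) (c : trunc_poly F alpha) : trunc_poly K alpha :=
  in_qpoly 'X^alpha (map_poly iota (c : {poly %/ ('X^alpha : {poly F})})).

Section Rep.
Variables (Q : quiver) (r : vertex Q -> nat).

(* A locally free representation of rank r, with bases of the free modules
   chosen: the module at i is 'cV[R]_(r i), and the matrix at the arrow a acts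
   on column vectors by left multiplication. *)
Definition rep (R : nzRingType) :=
  {dffun forall a : arrow Q, 'M[R]_(r (tgt a), r (src a))}.

Definition is_subrep (R : nzRingType) (x : rep R)
    (U : forall i : vertex Q, {pred 'cV[R]_(r i)}) : Prop :=
  (forall i, GRing.submod_closed (U i)) /\
  (forall a v, v \in U (src a) -> x a *m v \in U (tgt a)).

Definition nonzero_fam (R : nzRingType)
    (U : forall i : vertex Q, {pred 'cV[R]_(r i)}) : Prop :=
  exists i, exists2 v, v \in U i & v != 0.

Definition internal_direct_sum (R : nzRingType)
    (U W : forall i : vertex Q, {pred 'cV[R]_(r i)}) : Prop :=
  forall i,
    (forall v, exists2 u, u \in U i & exists2 w, w \in W i & v = u + w) /\
    (forall v, v \in U i -> v \in W i -> v = 0).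

Definition indecomposable (R : nzRingType) (x : rep R) : Prop :=
  nonzero_fam (fun i => [pred v : 'cV[R]_(r i) | true]) /\
  ~ exists U W : forall i : vertex Q, {pred 'cV[R]_(r i)},
      [/\ is_subrep x U, is_subrep x W, nonzero_fam U, nonzero_fam W
        & internal_direct_sum U W].

Definition base_change (F K : fieldType) (iota : {rmorphism F -> K})
    (alpha : nat) (x : rep (trunc_poly F alpha)) : rep (trunc_poly K alpha) :=
  [ffun a => map_mx (@trunc_map F K iota alpha) (x a)].

(* K is meant to be an algebraic closure of F via iota. *)
Definition abs_indecomposable (F K : fieldType) (iota : {rmorphism F -> K})
    (alpha : nat) (x : rep (trunc_poly F alpha)) : Prop :=
  indecomposable (base_change iota x).

Section Finite.
Variable R : finComUnitRingType.

Definition GLr : {set {dffun forall i : vertex Q, 'M[R]_(r i)}} :=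
  [set g : {dffun forall i : vertex Q, 'M[R]_(r i)}
     | [forall i, g i \in unitmx]].

Definition iso_rep : rel (rep R) := fun x y =>
  [exists g in GLr, [forall a, g (tgt a) *m x a == y a *m g (src a)]].

(* [conform_mx 0 A] only transports A along the equality r (tgt a) = r i
   (resp. r (src a) = r i); the default 0 is never used. *)
Definition moment_map (x : rep R)
    (y : {dffun forall a : arrow Q, 'M[R]_(r (src a), r (tgt a))})
    (i : vertex Q) : 'M[R]_(r i) :=
  \sum_(a : arrow Q | tgt a == i) conform_mx 0 (x a *m y a)
  - \sum_(a : arrow Q | src a == i) conform_mx 0 (y a *m x a).

Definition moment_fiber (c : vertex Q -> R) :=
  [set xy : rep R * {dffun forall a : arrow Q, 'M[R]_(r (src a), r (tgt a))}
     | [forall i, moment_map xy.1 xy.2 i == (c i)%:M]].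

End Finite.

(* The number of isomorphism classes; equals A_{Q,r,alpha}(#|F|) when K is an
   algebraic closure of F via iota.  [`[< P >]] is classical truth of P. *)
Definition num_abs_indec (F : finFieldType) (K : fieldType)
    (iota : {rmorphism F -> K}) (alpha : nat) : nat :=
  #|equivalence_partition (@iso_rep (trunc_poly F alpha))
      [set x : rep (trunc_poly F alpha) | `[< abs_indecomposable iota x >]]|.

End Rep.

(* Main.v *)
Require Import Defs.
From mathcomp Require Import all_boot all_order all_algebra.
From mathcomp Require Import boolp ring.
From HB Require Import structures.

Import Order.TTheory GRing.Theory Num.Theory.
Local Open Scope ring_scope.

Set Implicit Arguments.
Unset Strict Implicit.
Unset Printing Implicit Defensive.

(** Fix the half x of a point (x, y) of the moment fiber and count the y.  The
    moment equation is linear in y, and for the pairing given by the trace and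
    the coefficient of t^(alpha-1), which is perfect, the map y |-> mu(x, y) is
    adjoint to g |-> g x - x g ([moment_trace]).  Hence the equation
    mu(x, y) = t^(alpha-1) lambda is solvable exactly when every endomorphism g
    of x satisfies sum_i lambda_i tr(g_i mod t) = 0, and the number of its
    solutions is then |Y| |End x| / |gl|, where Y is the space of all y and gl
    that of all families g ([card_moment_solutions]); moreover
    |Y| / |gl| = q^(-alpha <r, r>).

    The solvable x are the absolutely indecomposable ones.  If a solution y
    exists, it still exists over K, so an idempotent endomorphism e of x over K
    satisfies sum_i lambda_i rank(e_i mod t) = 0 in K.  The bound on the
    characteristic turns this into an equality of integers, and genericity of
    lambda forces e to be 0 or 1 ([moment_fiber_abs_indecomposable]).
    Conversely, if x is absolutely indecomposable, Fitting's lemma over the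
    algebraically closed field K shows that an endomorphism g of x has a single
    eigenvalue c modulo t; as c^(r_i) = det(g_i mod t) lies in F for all i and
    the r_i are coprime, c lies in F ([abs_indecomposable_char_poly]).  So the
    weighted trace is c times lambda . r = 0.

    The same description of endomorphisms shows that g - c is invertible for
    all c in F but one, whence |Aut x| = (1 - q^-1) |End x| ([card_End_aut]).
    The fiber therefore has |Y| / |gl| times the sum of |Aut x| / (1 - q^-1)
    over absolutely indecomposable x as its cardinality, and by orbit counting
    |Aut x| sums to |GL(r)| over each isomorphism class ([sum_card_aut]). *)

(** * The truncated polynomial ring *)

Section TruncatedPolynomials.
Variables (F : fieldType) (a : nat).
Notation R := (trunc_poly F a.+1).

Definition tcoef (k : nat) (z : R) : F := (polyn z)`_k.

Lemma tcoef_ext (y z : R) :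
  (forall k, (k <= a)%N -> tcoef k y = tcoef k z) -> y = z.
Proof.
move=> eq_yz; apply: val_inj; apply/polyP => k.
have [/eq_yz // | lt_ak] := leqP k a.
have big (x : R) : (size (polyn x) <= k)%N.
  have := size_npoly x => /leq_trans; apply.
  by rewrite mk_monic_Xn size_polyXn.
by rewrite /= !nth_default ?big.
Qed.

Lemma tcoef_in_qpoly k (f : {poly F}) :
  (k <= a)%N -> tcoef k (in_qpoly 'X^(a.+1) f) = f`_k.
Proof.
move=> le_ka; rewrite /tcoef /= mk_monic_Xn /=.
have := Pdiv.RingMonic.rdivp_eq (monicXn F a.+1) f => def_f.
by rewrite [in RHS]def_f coefD coefMXn ltnS le_ka add0r.
Qed.

Lemma tcoefM k (y z : R) : (k <= a)%N ->
  tcoef k (y * z) = \sum_(j < k.+1) tcoef j y * tcoef (k - j) z.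
Proof. by move=> le_ka; rewrite [LHS]tcoef_in_qpoly // coefM. Qed.

Lemma tcoef1 k : tcoef k 1 = (k == 0)%:R.
Proof. by rewrite /tcoef /= coefC; case: eqP. Qed.

Fact tcoef_is_zmod_morphism k : zmod_morphism (tcoef k).
Proof. by move=> y z; rewrite /tcoef /= coefB. Qed.
HB.instance Definition _ k :=
  GRing.isZmodMorphism.Build R F (tcoef k) (tcoef_is_zmod_morphism k).

Definition residue : R -> F := tcoef 0.
Fact residue_is_zmod_morphism : zmod_morphism residue.
Proof. exact: tcoef_is_zmod_morphism. Qed.
Fact residue_is_monoid_morphism : monoid_morphism residue.
Proof.
split=> [|y z]; last by rewrite /residue tcoefM // big_ord1.
by rewrite /residue tcoef1.
Qed.
HB.instance Definition _ :=
  GRing.isZmodMorphism.Build R F residue residue_is_zmod_morphism.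
HB.instance Definition _ :=
  GRing.isMonoidMorphism.Build R F residue residue_is_monoid_morphism.

Definition tconst : F -> R := qpolyC 'X^(a.+1).
HB.instance Definition _ := GRing.RMorphism.on tconst.

Lemma tcoef_const k c : tcoef k (tconst c) = if k == 0%N then c else 0.
Proof. by rewrite /tcoef /= coefC. Qed.

Lemma tconstK : cancel tconst residue.
Proof. by move=> c; rewrite /residue tcoef_const. Qed.

Lemma tcoef_constM k c z : (k <= a)%N -> tcoef k (tconst c * z) = c * tcoef k z.
Proof.
move=> le_ka; rewrite tcoefM // big_ord_recl /= subn0 tcoef_const /=.
by rewrite big1 ?addr0 // => j _; rewrite tcoef_const mul0r.
Qed.

Lemma trunc_t_exp j : trunc_t F a.+1 ^+ j = in_qpoly 'X^(a.+1) 'X^j.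
Proof. by rewrite rmorphXn. Qed.

Lemma tcoef_tM k j z : (k <= a)%N ->
  tcoef k (trunc_t F a.+1 ^+ j * z) = if (k < j)%N then 0 else tcoef (k - j) z.
Proof.
move=> le_ka; rewrite trunc_t_exp.
have def_z : z = in_qpoly 'X^(a.+1) (polyn z).
  by apply: tcoef_ext => i le_ia; rewrite tcoef_in_qpoly.
by rewrite [in LHS]def_z -rmorphM [LHS]tcoef_in_qpoly // coefXnM.
Qed.

Lemma trunc_t_nilpotent : trunc_t F a.+1 ^+ a.+1 = 0.
Proof.
apply: tcoef_ext => k le_ka.
by rewrite -[_ ^+ _]mulr1 tcoef_tM // ltnS le_ka raddf0.
Qed.

(** Division by t on the multiples of t. *)
Definition tshift (z : R) : R :=
  in_qpoly 'X^(a.+1) (\poly_(i < a) (polyn z)`_i.+1).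

Lemma tshiftK z : residue z = 0 -> trunc_t F a.+1 * tshift z = z.
Proof.
move=> z0; apply: tcoef_ext => k le_ka.
rewrite -[trunc_t _ _]expr1 tcoef_tM //; case: k le_ka => [|k] le_ka //=.
by rewrite subn1 tcoef_in_qpoly ?(ltnW le_ka) // coef_poly le_ka.
Qed.

(** Such a matrix is t times another one, and t is central and nilpotent.  This
    is how statements about residues, where linear algebra over a field
    applies, are lifted to the truncated polynomial ring. *)
Lemma residue0_nilpotent n (A : 'M[R]_n) :
  map_mx residue A = 0 -> A ^+ a.+1 = 0.
Proof.
move=> A0; have -> : A = trunc_t F a.+1 *: map_mx tshift A.
  apply/matrixP=> i j; rewrite !mxE tshiftK //.
  by move/matrixP/(_ i j): A0; rewrite !mxE.
suff -> k : (trunc_t F a.+1 *: map_mx tshift A) ^+ k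
         = trunc_t F a.+1 ^+ k *: map_mx tshift A ^+ k.
  by rewrite trunc_t_nilpotent scale0r.
elim: k => [|k IHk]; first by rewrite !expr0 scale1r.
by rewrite !exprS IHk -[LHS]/(_ *m _) -scalemxAl -scalemxAr scalerA.
Qed.

(** This F-linear form is the residue pairing of the ring: together with
    [top_coef_nondegenerate] it makes F[t]/(t^alpha) a symmetric algebra, so
    that matrix spaces over it are self-dual over F through the trace. *)
Definition top_coef : R -> F := tcoef a.
HB.instance Definition _ :=
  GRing.isZmodMorphism.Build R F top_coef (tcoef_is_zmod_morphism a).

Lemma top_coef_tM z : top_coef (trunc_t F a.+1 ^+ a * z) = residue z.
Proof. by rewrite /top_coef tcoef_tM // ltnn subnn. Qed.

Lemma top_coef_constM c z : top_coef (tconst c * z) = c * top_coef z.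
Proof. exact: tcoef_constM. Qed.

(** If the coefficient of t^k in z is nonzero, multiplying by t^(alpha-1-k)
    moves it to the top. *)
Lemma top_coef_nondegenerate z : z != 0 -> exists s, top_coef (z * s) != 0.
Proof.
move=> nz_z.
have [/existsP[k zk] | ] := boolP [exists k : 'I_a.+1, tcoef k z != 0].
  exists (trunc_t F a.+1 ^+ (a - k)); rewrite mulrC /top_coef tcoef_tM //.
  by rewrite ltnNge leq_subr subKn // -ltnS.
rewrite negb_exists => /forallP z0; case/eqP: nz_z; apply: tcoef_ext => k le_ka.
by have /negbNE/eqP := z0 (Ordinal (le_ka : (k < a.+1)%N)); rewrite raddf0.
Qed.

End TruncatedPolynomials.

Section BaseChange.
Variables (F K : fieldType) (iota : {rmorphism F -> K}) (a : nat).
Notation phi := (@trunc_map F K iota a.+1).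

Lemma tcoef_trunc_map k z : (k <= a)%N -> tcoef k (phi z) = iota (tcoef k z).
Proof. by move=> le_ka; rewrite tcoef_in_qpoly // coef_map. Qed.

Fact trunc_map_is_zmod_morphism : zmod_morphism phi.
Proof.
move=> y z; apply: tcoef_ext => k le_ka.
by rewrite [RHS]raddfB/= !tcoef_trunc_map // raddfB rmorphB.
Qed.
Fact trunc_map_is_monoid_morphism : monoid_morphism phi.
Proof.
split=> [|y z]; apply: tcoef_ext => k le_ka.
  by rewrite tcoef_trunc_map // !tcoef1 rmorph_nat.
rewrite tcoef_trunc_map // !tcoefM // rmorph_sum; apply: eq_bigr => j _.
have le_ja : (j <= a)%N by rewrite (leq_trans _ le_ka) // -ltnS.
by rewrite rmorphM !tcoef_trunc_map // (leq_trans (leq_subr _ _)).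
Qed.
HB.instance Definition _ :=
  GRing.isZmodMorphism.Build _ _ phi trunc_map_is_zmod_morphism.
HB.instance Definition _ :=
  GRing.isMonoidMorphism.Build _ _ phi trunc_map_is_monoid_morphism.

Lemma residue_trunc_map z : residue (phi z) = iota (residue z).
Proof. exact: tcoef_trunc_map. Qed.

Lemma trunc_map_t : phi (trunc_t F a.+1) = trunc_t K a.+1.
Proof.
apply: tcoef_ext => k le_ka.
by rewrite tcoef_trunc_map // !tcoef_in_qpoly // !coefX rmorph_nat.
Qed.

End BaseChange.

Lemma card_trunc_poly (F : finFieldType) a :
  #|trunc_poly F a.+1| = (#|F| ^ a.+1)%N.
Proof. by rewrite card_monic_qpoly ?size_polyXn ?monicXn. Qed.

(** * Matrices over the truncated polynomial ring *)

(** In a full-rank factorization A = C B of an idempotent A, the product B C is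
    an identity matrix, whose trace is the rank. *)
Lemma mxtrace_idempotent (F : fieldType) n (A : 'M[F]_n) :
  A *m A = A -> \tr A = (\rank A)%:R.
Proof.
move=> idA; have := mulmx_base A.
have := @row_full_inj _ _ _ (\rank A) _ (col_base_full A).
have := @row_free_inj _ n _ _ _ (row_base_free A).
move: (col_base A) (row_base A) => C B B_inj C_inj defA.
have BC : B *m C = 1%:M.
  apply/C_inj/B_inj => /=.
  by rewrite mulmx1 !mulmxA defA -mulmxA defA.
by rewrite -[in LHS]defA mxtrace_mulC BC mxtrace1.
Qed.

Section ResidueMatrices.
Variables (F : fieldType) (a : nat).
Notation R := (trunc_poly F a.+1).
Notation res := (@residue F a).

Lemma unit_residue (z : R) : (z \is a GRing.unit) = (res z != 0).
Proof.
apply/idP/idP => [uz | nz_z]; first by rewrite -unitfE rmorph_unit.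
pose y := 1 - tconst a (res z)^-1 * z.
have y_nil : y ^+ a.+1 = 0.
  have: (y%:M : 'M_1) ^+ a.+1 = 0.
    apply: residue0_nilpotent; rewrite map_scalar_mx rmorphB rmorphM rmorph1.
    by rewrite /= tconstK mulVf // subrr raddf0.
  by rewrite -rmorphXn => /matrixP/(_ 0 0); rewrite !mxE eqxx mulr1n.
apply/unitrPr; exists (tconst a (res z)^-1 * \sum_(i < a.+1) y ^+ i).
have /eqP : y ^+ a.+1 - 1 =
    - (tconst a (res z)^-1 * z) * (\sum_(i < a.+1) y ^+ i).
  by rewrite subrX1; congr (_ * _); rewrite addrC addKr.
by rewrite y_nil sub0r mulNr eqr_opp => /eqP->; rewrite mulrCA mulrA.
Qed.

Lemma unitmx_residue n (A : 'M[R]_n) :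
  (A \in unitmx) = (map_mx res A \in unitmx).
Proof. by rewrite !unitmxE det_map_mx unit_residue unitfE. Qed.

(** An idempotent equals all its powers, and a matrix with zero residue is
    nilpotent. *)
Lemma idempotent_residue0 n (E : 'M[R]_n) :
  E *m E = E -> map_mx res E = 0 -> E = 0.
Proof.
move=> idE /residue0_nilpotent => <-.
suff -> k : E ^+ k.+1 = E by [].
by elim: k => [|k IHk] //; rewrite exprS IHk.
Qed.

(** Evaluation at A of a polynomial over the residue field.  The explicit
    sum also makes sense for the empty matrices at vertices of rank 0. *)
Definition polymx n (f : {poly F}) (A : 'M[R]_n) : 'M[R]_n :=
  \sum_(k < size f) tconst a f`_k *: A ^+ k.

Lemma polymx_horner n (A : 'M[R]_n.+1) f :
  polymx f A = horner_mx A (map_poly (tconst a) f).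
Proof.
rewrite -[f in RHS]coefK poly_def !rmorph_sum /=; apply: eq_bigr => k _.
by rewrite map_polyZ map_polyXn linearZ /= rmorphXn /= horner_mx_X.
Qed.

Lemma polymxM n (A : 'M[R]_n) f g : polymx (f * g) A = polymx f A *m polymx g A.
Proof.
case: n A => [|n] A; first by apply/matrixP => -[].
by rewrite !polymx_horner !rmorphM.
Qed.

Lemma polymxB n (A : 'M[R]_n) f g : polymx (f - g) A = polymx f A - polymx g A.
Proof.
case: n A => [|n] A; first by apply/matrixP => -[].
by rewrite !polymx_horner !rmorphB.
Qed.

Lemma polymx1 n (A : 'M[R]_n) : polymx 1 A = 1%:M.
Proof.
case: n A => [|n] A; first by apply/matrixP => -[].
by rewrite !polymx_horner !rmorph1.
Qed.

Lemma polymxX n (A : 'M[R]_n) f k : polymx (f ^+ k) A = polymx f A ^+ k.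
Proof.
elim: k => [|k IHk]; first by rewrite !expr0 polymx1.
by rewrite !exprS polymxM IHk.
Qed.

Lemma residue_polymx n (A : 'M[R]_n.+1) f :
  map_mx res (polymx f A) = horner_mx (map_mx res A) f.
Proof.
rewrite polymx_horner map_horner_mx -map_poly_comp map_poly_id => [|z _].
  exact: erefl.
exact: tconstK.
Qed.

(** This makes the polynomials in an endomorphism endomorphisms. *)
Lemma polymx_intertwine m n (A : 'M[R]_m) (B : 'M[R]_n) (X : 'M[R]_(m, n)) f :
  A *m X = X *m B -> polymx f A *m X = X *m polymx f B.
Proof.
move=> AX; rewrite mulmx_suml mulmx_sumr; apply: eq_bigr => k _.
rewrite -scalemxAl -scalemxAr; congr (_ *: _).
elim: {k}(k : nat) => [|k IHk]; first by rewrite !expr0 mul1mx mulmx1.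
by rewrite !exprSr -!mulmxE -mulmxA AX !mulmxA IHk.
Qed.

(** By Cayley-Hamilton, f kills A modulo t, so that f(A) is nilpotent. *)
Lemma polymx_char_poly n (A : 'M[R]_n) f :
  char_poly (map_mx res A) %| f -> polymx (f ^+ a.+1) A = 0.
Proof.
case: n A => [|n] A dvd_f; first by apply/matrixP => -[].
rewrite polymxX; apply: residue0_nilpotent; rewrite residue_polymx.
case/dvdpP: dvd_f => g ->; rewrite rmorphM /=.
by rewrite [X in _ * X]Cayley_Hamilton mulr0.
Qed.

(** The minimal polynomial of the residue of A divides f and has the same roots
    as the characteristic polynomial. *)
Lemma root_polymx0 n (A : 'M[R]_n) f c :
  polymx f A = 0 -> root (char_poly (map_mx res A)) c -> root f c.
Proof.
case: n A => [|n] A fA0.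
  by rewrite /char_poly det_mx00 rootE hornerC oner_eq0.
rewrite -root_mxminpoly => rc; apply: root_dvdp rc; apply: mxminpoly_min.
by rewrite -residue_polymx fA0 raddf0.
Qed.

End ResidueMatrices.

(** * Decompositions and idempotent endomorphisms *)

Lemma mx_neq0_col (R : nzRingType) m n (A : 'M[R]_(m, n)) :
  A != 0 -> exists v : 'cV_n, A *m v != 0.
Proof.
move=> nzA.
have [/existsP[j Aj]|] := boolP [exists j, A *m delta_mx j (0 : 'I_1) != 0].
  by exists (delta_mx j 0).
rewrite negb_exists => /forallP A0; case/eqP: nzA; apply/matrixP => i j.
by have /negbNE/eqP/matrixP/(_ i 0) := A0 j; rewrite -colE !mxE.
Qed.

Lemma submod_closed_lincomb (R : nzRingType) (V : lmodType R) (U : {pred V})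
  (I : finType) (c : I -> R) (u : I -> V) :
  GRing.submod_closed U -> (forall i, u i \in U) -> \sum_i c i *: u i \in U.
Proof.
move=> [U0 UP] Uu; elim/big_rec: _ => [|i v _ Uv]; first exact: U0.
exact: UP.
Qed.

Section Endomorphisms.
Variables (Q : quiver) (r : vertex Q -> nat) (R : comNzRingType) (x : rep r R).

Definition endo (g : forall i, 'M[R]_(r i)) : Prop :=
  forall a, g (tgt a) *m x a = x a *m g (src a).

(** Otherwise the fixed vectors and the kernel of e decompose x. *)
Lemma indecomposable_idempotent (e : forall i, 'M[R]_(r i)) :
  indecomposable x -> endo e -> (forall i, e i *m e i = e i) ->
  (forall i, e i = 0) \/ (forall i, e i = 1%:M).
Proof.
move=> [_ indec] xe idem_e.
have [/existsP[i ei0]|] := boolP [exists i, e i != 0]; last first.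
  by rewrite negb_exists => /forallP e0; left=> i; apply/eqP/negbNE/e0.
have [/existsP[j ej1]|] := boolP [exists i, e i != 1%:M]; last first.
  by rewrite negb_exists => /forallP e0; right=> k; apply/eqP/negbNE/e0.
pose U i : {pred 'cV_(r i)} := [pred v | e i *m v == v].
pose W i : {pred 'cV_(r i)} := [pred v | e i *m v == 0].
case: indec; exists U, W; split.
- split=> [k | b v].
    split=> [|c u v]; rewrite !inE ?mulmx0 // => /eqP eu /eqP ev.
    by rewrite mulmxDr -scalemxAr eu ev.
  by rewrite !inE => /eqP ev; rewrite mulmxA xe -mulmxA ev.
- split=> [k | b v].
    split=> [|c u v]; rewrite !inE ?mulmx0 // => /eqP eu /eqP ev.
    by rewrite mulmxDr -scalemxAr eu ev scaler0 addr0.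
  by rewrite !inE => /eqP ev; rewrite mulmxA xe -mulmxA ev mulmx0.
- have [v ev] := mx_neq0_col ei0.
  by exists i, (e i *m v) => //; rewrite inE mulmxA idem_e.
- have := ej1; rewrite -subr_eq0 => /mx_neq0_col[v ev].
  exists j, ((e j - 1%:M) *m v) => //.
  by rewrite inE mulmxA mulmxBr idem_e mulmx1 subrr mul0mx.
move=> k; split=> [v | v]; last by rewrite !inE => /eqP {2}<- /eqP.
exists (e k *m v); first by rewrite inE mulmxA idem_e.
exists (v - e k *m v); last by rewrite addrC subrK.
by rewrite inE mulmxBr mulmxA idem_e subrr.
Qed.

(** The converse: the projection onto the first summand of a decomposition along
    the second is an idempotent endomorphism. *)
Lemma idempotent_indecomposable :
  (exists i, r i != 0%N) ->
  (forall e, endo e -> (forall i, e i *m e i = e i) ->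
     (forall i, e i = 0) \/ (forall i, e i = 1%:M)) ->
  indecomposable x.
Proof.
move=> [i ri] triv; split.
  exists i, (const_mx 1) => //; apply/eqP => /matrixP.
  by case: (r i) ri => // n _ /(_ 0 0)/eqP; rewrite !mxE oner_eq0.
case=> U [W [[subU xU] [subW xW] [k [u Uu nz_u]] [l [w Ww nz_w]] UW]].
(* The projection is built from choices of components of the basis vectors;
   linear combinations show that it has the right value on every vector. *)
have projP j v : exists u, (u \in U j) && (v - u \in W j).
  have [/(_ v)[u' Uu' [w' Ww' ->]] _] := UW j.
  by exists u'; rewrite Uu' addrC addKr.
pose e j := \matrix_(s, t) xchoose (projP j (delta_mx t 0)) s 0.
have eE j (v : 'cV_(r j)) :
    e j *m v = \sum_t v t 0 *: xchoose (projP j (delta_mx t 0)).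
  apply/matrixP=> s z; rewrite !mxE summxE ord1; apply: eq_bigr => t _.
  by rewrite !mxE mulrC.
have Ue j (v : 'cV_(r j)) : e j *m v \in U j.
  rewrite eE; apply: submod_closed_lincomb => // t.
  by have /andP[] := xchooseP (projP j (delta_mx t 0)).
have We j (v : 'cV_(r j)) : v - e j *m v \in W j.
  rewrite eE {1}[v]matrix_sum_delta.
  under eq_bigr do rewrite big_ord1.
  rewrite -sumrB; under eq_bigr do rewrite -scalerBr.
  apply: submod_closed_lincomb => // t.
  by have /andP[] := xchooseP (projP j (delta_mx t 0)).
have BU j v v' : v \in U j -> v' \in U j -> v - v' \in U j.
  by move=> Uv Uv'; rewrite addrC -scaleN1r; apply: (subU j).2.
have BW j v v' : v \in W j -> v' \in W j -> v - v' \in W j.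
  by move=> Uv Uv'; rewrite addrC -scaleN1r; apply: (subW j).2.
have e_uniq j (v v' : 'cV_(r j)) :
    v' \in U j -> v - v' \in W j -> e j *m v = v'.
  move=> Uv' Wv'; apply/eqP; rewrite -subr_eq0; apply/eqP.
  have [_ UW0] := UW j; apply: UW0; first exact: BU.
  have -> : e j *m v - v' = (v - v') - (v - e j *m v).
    by rewrite opprB [RHS]addrC addrA subrK.
  exact: (BW _ _ _ Wv' (We _ _)).
have eU j v : v \in U j -> e j *m v = v.
  by move=> Uv; apply: e_uniq => //; rewrite subrr; apply: (subW j).1.
have eW j v : v \in W j -> e j *m v = 0.
  by move=> Wv; apply: e_uniq; [apply: (subU j).1 | rewrite subr0].
have mulcol m n (A B : 'M[R]_(m, n)) :
    (forall v : 'cV_n, A *m v = B *m v) -> A = B.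
  move=> AB; apply/eqP; rewrite -subr_eq0; apply/eqP.
  by apply: contrapT => /eqP/mx_neq0_col[v]; rewrite mulmxBl AB subrr eqxx.
have [b | j | e0 | e1] := triv e.
- apply: mulcol => v; rewrite -!mulmxA.
  apply: e_uniq; first exact: (xU _ _ (Ue _ _)).
  by rewrite -mulmxBr; apply: xW; apply: We.
- by apply: mulcol => v; rewrite -mulmxA eU.
- by case/eqP: nz_u; rewrite -(eU _ _ Uu) e0 mul0mx.
by case/eqP: nz_w; rewrite -(eW _ _ Ww) e1 mul1mx.
Qed.

End Endomorphisms.

(** * Endomorphisms of absolutely indecomposable representations *)

Lemma closed_single_root (K : closedFieldType) (f : {poly K}) c :
  f \is monic -> (forall z, root f z -> z = c) ->
  f = ('X - c%:P) ^+ (size f).-1.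
Proof.
move=> /monicP mon_f root_c.
have [s def_f] := closed_field_poly_normal f; rewrite mon_f scale1r in def_f.
have {root_c} /all_pred1P def_s : all (pred1 c) s.
  by apply/allP => z sz /=; rewrite (root_c z) // def_f root_prod_XsubC.
rewrite def_f size_prod_XsubC /= def_s size_nseq.
by elim: (size s) => [|n IHn]; rewrite ?big_nil // big_cons IHn exprS.
Qed.

(** Write P = (X - c)^m q with q prime to X - c; a Bezout relation
    u (X - c)^m + v q = 1 gives f = v q.  Evaluated at an endomorphism killed
    by P, this f is the projection onto the generalized eigenspace of c. *)
Lemma fitting_idempotent (K : fieldType) (P : {poly K}) c :
  P != 0 -> root P c ->
  exists f, [/\ P %| f * (1 - f), f.[c] = 1
              & forall z, z != c -> root P z -> f.[z] = 0].
Proof.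
move=> nzP Pc; have [m [q]] := multiplicity_XsubC P c.
rewrite nzP /= => qc def_P.
have m_gt0 : (0 < m)%N.
  by case: m def_P => // def_P; rewrite def_P mulr1 (negPf qc) in Pc.
have : coprimep (('X - c%:P) ^+ m) q.
  by rewrite coprimep_expl // coprimep_sym coprimep_XsubC.
case/Bezout_eq1_coprimepP => -[u v] /= uv.
have def_u : 1 - v * q = u * ('X - c%:P) ^+ m by rewrite -uv addrK.
exists (v * q); split.
- by rewrite def_u def_P mulrACA dvdp_mull.
- have -> : v * q = 1 - u * ('X - c%:P) ^+ m by rewrite -def_u subKr.
  by rewrite !hornerE subrr expr0n eqn0Ngt m_gt0 mulr0 subr0.
move=> z zc; rewrite def_P rootM => /orP[/rootP qz|].
  by rewrite hornerM qz mulr0.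
by rewrite rootE !hornerE expf_eq0 subr_eq0 (negPf zc) andbF.
Qed.

Section ClosedField.
Variables (Q : quiver) (r : vertex Q -> nat) (K : closedFieldType) (a : nat).
Notation R := (trunc_poly K a.+1).

(** Fitting's lemma: if there were two distinct eigenvalues among those of all
    the residue matrices of h, the projection onto a generalized eigenspace of h
    would be a nontrivial idempotent endomorphism. *)
Lemma indecomposable_char_poly (x : rep r R) (h : forall i, 'M[R]_(r i)) :
  indecomposable x -> endo x h ->
  exists c, forall i,
    char_poly (map_mx (@residue K a) (h i)) = ('X - c%:P) ^+ r i.
Proof.
move=> indec xh; pose chi i := char_poly (map_mx (@residue K a) (h i)).
have [[i0 [v _ nz_v]] _] := indec.
have [c chi_c] : exists c, root (chi i0) c.
  apply/closed_rootP; rewrite size_char_poly eqSS; apply: contraNN nz_v => r0.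
  by apply/eqP/matrixP => s; have := ltn_ord s; rewrite {2}(eqP r0).
suff root_c i z : root (chi i) z -> z = c.
  exists c => i; rewrite -/(chi i).
  rewrite [LHS](@closed_single_root _ _ c) ?char_poly_monic //.
    by rewrite size_char_poly.
  exact: root_c.
move=> chi_z; apply/eqP; apply: contraT => zc.
pose P := \prod_i chi i.
have chiP j : chi j %| P by rewrite /P (bigD1 j) //= dvdp_mulIl.
have nzP : P ^+ a.+1 != 0.
  by apply/expf_neq0/prodf_neq0 => j _; rewrite monic_neq0 ?char_poly_monic.
have chi_root w j : root (chi j) w -> root (P ^+ a.+1) w.
  by move=> /(root_dvdp (chiP j)); rewrite /root horner_exp expf_eq0 => ->.
have [f [Pf fc fz]] := fitting_idempotent nzP (chi_root _ _ chi_c).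
(* P is a common multiple of the residue characteristic polynomials, and its
   power kills every h j, so f becomes idempotent there. *)
have idem j : polymx (f * (1 - f)) (h j) = 0.
  have /dvdpP[g ->] := Pf.
  by rewrite polymxM (polymx_char_poly (chiP j)) mulmx0.
have [b | j | f0 | f1] :=
  @indecomposable_idempotent _ _ _ _ (fun j => polymx f (h j)) indec.
- exact: polymx_intertwine.
- rewrite -polymxM; apply/esym/eqP; rewrite -subr_eq0 -polymxB.
  by rewrite -[X in X - _]mulr1 -mulrBr idem.
- have /rootP/eqP := root_polymx0 (f0 i0) chi_c.
  by rewrite fc oner_eq0.
have /rootP/eqP : root (1 - f) z.
  by apply: root_polymx0 chi_z; rewrite polymxB polymx1 f1 subrr.
by rewrite !hornerE (fz z zc (chi_root _ _ chi_z)) subr0 oner_eq0.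
Qed.

End ClosedField.

Lemma rational_power_gcd (F K : fieldType) (iota : {rmorphism F -> K}) c m n :
  c != 0 -> (exists d, iota d = c ^+ m) -> (exists d, iota d = c ^+ n) ->
  exists d, iota d = c ^+ gcdn m n.
Proof.
move=> nz_c [d def_d] [e def_e].
have [->|m_gt0] := posnP m; first by rewrite gcd0n; exists e.
have [u v def_g _] := egcdnP n m_gt0.
exists (d ^+ u / e ^+ v); rewrite rmorphM fmorphV !rmorphXn /= def_d def_e.
apply: (mulIf (expf_neq0 v (expf_neq0 n nz_c))).
rewrite mulfVK ?expf_neq0 // -!exprM -exprD; congr (_ ^+ _).
by rewrite mulnC def_g addnC (mulnC v).
Qed.

(** By Bezout, c is a product of integer powers of the c^(r_i). *)
Lemma indivisible_rational (Q : quiver) (r : vertex Q -> nat) (F K : fieldType)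
  (iota : {rmorphism F -> K}) c :
  indivisible r -> (forall i, exists d, iota d = c ^+ r i) ->
  exists d, iota d = c.
Proof.
move=> [_ gcd1] rat_c; have [->|nz_c] := eqVneq c 0.
  by exists 0; rewrite rmorph0.
rewrite -[c]expr1 -gcd1.
elim/big_rec: _ => [|i n _]; first by exists 1; rewrite rmorph1.
exact: rational_power_gcd.
Qed.

Section BaseChangeEndo.
Variables (Q : quiver) (r : vertex Q -> nat).
Variables (F : fieldType) (K : closedFieldType).
Variables (iota : {rmorphism F -> K}) (a : nat).
Notation phi := (@trunc_map F K iota a.+1).

Lemma endo_base_change (x : rep r (trunc_poly F a.+1)) g :
  endo x g -> endo (base_change iota x) (fun i => map_mx phi (g i)).
Proof. by move=> xg b; rewrite ffunE -!map_mxM xg. Qed.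

(** Over K there is a single eigenvalue c.  The determinants of the residues are
    the powers c^(r_i) and lie in F, and indivisibility brings c itself down
    to F. *)
Lemma abs_indecomposable_char_poly (x : rep r (trunc_poly F a.+1)) g :
  indivisible r -> abs_indecomposable iota x -> endo x g ->
  exists c, forall i,
    char_poly (map_mx (@residue F a) (g i)) = ('X - c%:P) ^+ r i.
Proof.
move=> indiv indec /endo_base_change /(indecomposable_char_poly indec)[c chi_c].
have {}chi_c i : map_poly iota (char_poly (map_mx (@residue F a) (g i)))
    = ('X - c%:P) ^+ r i.
  rewrite -chi_c map_char_poly -!map_mx_comp; congr char_poly.
  by apply: eq_map_mx => z /=; rewrite residue_trunc_map.
have [i | d def_c] := @indivisible_rational Q r _ _ iota c indiv.
  exists (\det (map_mx (@residue F a) (g i))).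
  have /(congr1 (coefp 0)) := chi_c i.
  rewrite /= coef_map char_poly_det -horner_coef0 !hornerE /=.
  rewrite -[- c]mulN1r exprMn.
  by rewrite rmorphM rmorph_sign; apply: mulfI; rewrite signr_eq0.
exists d => i; apply: (map_poly_inj iota).
by rewrite chi_c rmorphXn rmorphB /= map_polyX map_polyC /= def_c.
Qed.

End BaseChangeEndo.

(** * The moment map and the trace pairing *)

Section MomentTrace.
Variables (Q : quiver) (r : vertex Q -> nat).

(** The moment map over an arbitrary commutative ring: it is needed over the
    infinite ring K[t]/(t^alpha). *)
Definition moment (R : comNzRingType)
    (x : forall a, 'M[R]_(r (tgt a), r (src a)))
    (y : forall a, 'M[R]_(r (src a), r (tgt a))) (i : vertex Q) : 'M[R]_(r i) :=
  \sum_(a : arrow Q | tgt a == i) conform_mx 0 (x a *m y a)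
  - \sum_(a : arrow Q | src a == i) conform_mx 0 (y a *m x a).

(** The map y |-> moment x y is adjoint, for the trace pairings, to the map
    g |-> g x - x g, whose kernel consists of the endomorphisms of x. *)
Lemma moment_trace (R : comNzRingType)
    (x : forall a, 'M[R]_(r (tgt a), r (src a)))
    (y : forall a, 'M[R]_(r (src a), r (tgt a))) (g : forall i, 'M[R]_(r i)) :
  \sum_i \tr (g i *m moment x y i) =
  \sum_a \tr ((g (tgt a) *m x a - x a *m g (src a)) *m y a).
Proof.
have fiberwise (v : arrow Q -> vertex Q) (X : forall a, 'M[R]_(r (v a))) :
    \sum_i \sum_(a | v a == i) \tr (g i *m conform_mx 0 (X a))
    = \sum_a \tr (g (v a) *m X a).
  rewrite [RHS](partition_big v predT) //=; apply: eq_bigr => i _.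
  by apply: eq_bigr => a /eqP <-; rewrite conform_mx_id.
have tr_sum i (P : pred (arrow Q)) (X : arrow Q -> 'M_(r i)) :
    \tr (g i *m (\sum_(a | P a) X a)) = \sum_(a | P a) \tr (g i *m X a).
  by rewrite mulmx_sumr raddf_sum.
under eq_bigr do rewrite mulmxBr raddfB /= !tr_sum.
rewrite sumrB !fiberwise -sumrB; apply: eq_bigr => a _.
by rewrite mulmxBl raddfB /= -!mulmxA [in X in _ = _ - X]mxtrace_mulC -mulmxA.
Qed.

Lemma eq_moment (R : comNzRingType)
    (x x' : forall a, 'M[R]_(r (tgt a), r (src a)))
    (y : forall a, 'M[R]_(r (src a), r (tgt a))) i :
  (forall a, x a = x' a) -> moment x y i = moment x' y i.
Proof. by move=> eq_x; congr (_ - _); apply: eq_bigr => a _; rewrite eq_x. Qed.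

Lemma map_moment (R S : comNzRingType) (f : {rmorphism R -> S})
    (x : forall a, 'M[R]_(r (tgt a), r (src a)))
    (y : forall a, 'M[R]_(r (src a), r (tgt a))) i :
  map_mx f (moment x y i)
  = moment (fun a => map_mx f (x a)) (fun a => map_mx f (y a)) i.
Proof.
rewrite /moment map_mxB.
by congr (_ - _); rewrite raddf_sum; apply: eq_bigr => a _ /=;
  rewrite map_conform_mx map_mx0 map_mxM.
Qed.

End MomentTrace.

Section FiberIndecomposable.
Variables (Q : quiver) (r : vertex Q -> nat) (lambda : vertex Q -> int).
Variables (F : finFieldType) (p : nat) (K : closedFieldType).
Variables (iota : {rmorphism F -> K}) (a : nat).
Notation R := (trunc_poly F a.+1).
Hypotheses (hr : indivisible r) (hlambda : generic lambda r).
Hypothesis hp : p \in [pchar F].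
Hypothesis hchar : (\sum_(i : vertex Q) `|lambda i| * r i < p)%N.

Definition t_lambda (L : fieldType) i : trunc_poly L a.+1 :=
  trunc_t L a.+1 ^+ a * (lambda i)%:~R.

Lemma top_coef_t_lambda (L : fieldType)
    (g : forall i, 'M[trunc_poly L a.+1]_(r i)) :
  top_coef (\sum_i \tr (g i *m (t_lambda L i)%:M)) =
  \sum_i (lambda i)%:~R * \tr (map_mx (@residue L a) (g i)).
Proof.
rewrite raddf_sum; apply: eq_bigr => i _ /=.
rewrite mul_mx_scalar mxtraceZ -mulrA top_coef_tM rmorphM rmorph_int /=.
by rewrite trace_map_mx.
Qed.

(** The integer pairing is smaller than p in absolute value, so its vanishing in
    K makes it zero, and genericity applies. *)
Lemma pairing_pchar0 (s : vertex Q -> nat) :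
  (forall i, (s i <= r i)%N) -> \sum_i (lambda i)%:~R * (s i)%:R = 0 :> K ->
  (forall i, s i = 0%N) \/ (forall i, s i = r i).
Proof.
move=> le_sr sum0.
have hpK : p \in [pchar K] by rewrite (fmorph_pchar iota).
have pair0 : pairing lambda s = 0.
  apply/eqP; rewrite -absz_eq0.
  have : (`|pairing lambda s| < p)%N.
    apply: leq_ltn_trans hchar; rewrite -lez_nat abszE.
    apply: le_trans (ler_norm_sum _ _ _) _.
    rewrite (raddf_sum Posz) /=; apply: ler_sum => i _.
    rewrite normrM [`|(s i)%:Z|]ger0_norm // PoszM abszE.
    by rewrite ler_wpM2l // lez_nat.
  have : (p %| `|pairing lambda s|)%N.
    have -> : (p %| `|pairing lambda s|)%N = (p %| pairing lambda s)%Z by [].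
    rewrite (dvdz_pcharf hpK) rmorph_sum -[X in _ == X]sum0.
    by apply/eqP/eq_bigr => i _; rewrite rmorphM.
  by case: `|_|%N => // n /dvdn_leq le_p; rewrite ltnNge (le_p isT).
have [/existsP[i si]|] := boolP [exists i, s i != 0%N]; last first.
  by rewrite negb_exists => /forallP e0; left=> i; apply/eqP/negbNE/e0.
have [/existsP[j sj]|] := boolP [exists i, s i != r i]; last first.
  by rewrite negb_exists => /forallP e0; right=> k; apply/eqP/negbNE/e0.
have [_ gen] := hlambda.
by have := gen s le_sr (ex_intro _ i si) (ex_intro _ j sj); rewrite pair0.
Qed.

(** The moment equation survives base change to K.  Pairing it with an
    idempotent endomorphism e gives sum_i lambda_i tr(e_i mod t) = 0, and the
    traces are the ranks s_i <= r_i of idempotents; by genericity s is 0 or r,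
    so e is 0 or 1. *)
Lemma moment_fiber_abs_indecomposable (x : rep r R) y :
  (forall i, moment_map x y i = (t_lambda F i)%:M) -> abs_indecomposable iota x.
Proof.
move=> fib; have [[i0 ri0] _] := hr.
apply: idempotent_indecomposable; first by exists i0.
move=> e xe idem_e; pose rk i := \rank (map_mx (@residue K a) (e i)).
have idem_res i : map_mx (@residue K a) (e i) *m map_mx (@residue K a) (e i)
                  = map_mx (@residue K a) (e i).
  by rewrite -map_mxM idem_e.
have [] := @pairing_pchar0 rk; first by move=> i; apply: rank_leq_row.
(* Two evaluations of the trace of e against the moment map: it is the weighted
   sum of ranks, and it vanishes since e commutes with x. *)
- rewrite -[LHS](_ :
    \sum_i (lambda i)%:~R * \tr (map_mx (@residue K a) (e i)) = _).
    rewrite -top_coef_t_lambda.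
    have -> : \sum_i \tr (e i *m (t_lambda K i)%:M) =
        \sum_i \tr (e i *m moment (base_change iota x)
          (fun b => map_mx (@trunc_map F K iota a.+1) (y b)) i).
      apply: eq_bigr => i _; congr (\tr (_ *m _)).
      have -> : t_lambda K i = @trunc_map F K iota a.+1 (t_lambda F i).
        by rewrite rmorphM rmorphXn rmorph_int /= trunc_map_t.
      rewrite -map_scalar_mx -fib -[moment_map x y i]/(moment x y i) map_moment.
      by apply: eq_moment => b; rewrite ffunE.
    rewrite moment_trace big1 ?raddf0 // => b _.
    by rewrite xe subrr mul0mx raddf0.
  by apply: eq_bigr => i _; rewrite mxtrace_idempotent.
- move=> rk0; left=> i; apply: (idempotent_residue0 (idem_e i)).
  by apply/eqP; rewrite -mxrank_eq0 -/(rk i) rk0.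
move=> rkr; right=> i; apply/eqP; rewrite eq_sym -subr_eq0; apply/eqP.
apply: idempotent_residue0.
  by rewrite mulmxBr mulmx1 mulmxBl mul1mx idem_e subrr subr0.
have u_e : map_mx (@residue K a) (e i) \in unitmx.
  by rewrite -row_free_unit -row_leq_rank -/(rk i) rkr.
rewrite raddfB /= map_mx1 -(mulKmx u_e (map_mx _ (e i))) idem_res mulVmx //.
by rewrite subrr.
Qed.

End FiberIndecomposable.

(** * Counting solutions of the moment equation *)

Section CharacterSums.
Variables (F : finFieldType) (a : nat).
Notation R := (trunc_poly F a.+1).

(** The value at z of the sum of all nontrivial additive characters of F, which
    is an integer.  It serves as a substitute for a single character: it
    averages to zero and is nonzero at 0. *)
Definition nontriv_chars (z : F) : int := (if z == 0 then #|F|%:Z else 0) - 1.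

Lemma sum_nontriv_chars b : \sum_z nontriv_chars (b + z) = 0.
Proof.
rewrite (reindex_inj (addrI (- b))) /=.
under eq_bigr do rewrite addrA subrr add0r.
rewrite sumrB -big_mkcond big_pred1_eq sumr_const.
by rewrite -[#|F|%:Z]mul1r -natz mulr_natr subrr.
Qed.

Lemma nontriv_chars0_neq0 : nontriv_chars 0 != 0.
Proof.
rewrite /nontriv_chars eqxx subr_eq0 eqz_nat neq_ltn; apply/orP; right.
exact: card_finNzRing_gt1.
Qed.

Lemma sum_equidistributed (T : finType) (f : T -> F) (shift : F -> T -> T) :
  (forall b, injective (shift b)) -> (forall b v, f (shift b v) = f v + b) ->
  \sum_v nontriv_chars (f v) = 0.
Proof.
move=> shift_inj f_shift; apply/eqP.
have: #|F|%:Z * \sum_v nontriv_chars (f v) == 0.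
  rewrite -natz -sumr_const mulr_suml.
  have shiftE b :
      1 * \sum_v nontriv_chars (f v) = \sum_v nontriv_chars (f v + b).
    rewrite mul1r (reindex_inj (shift_inj b)).
    by under eq_bigr do rewrite f_shift.
  rewrite (eq_bigr _ (fun b _ => shiftE b)).
  by rewrite exchange_big big1 // => v _; rewrite sum_nontriv_chars.
by rewrite mulf_eq0 eqz_nat -[_ == _]negbK -lt0n (ltnW (card_finNzRing_gt1 _)).
Qed.

Lemma mxtrace_delta_mul m n (D : 'M[R]_(m, n)) k l s :
  \tr (s *: delta_mx l k *m D) = s * D k l.
Proof.
rewrite -scalemxAl mxtraceZ; congr (_ * _); rewrite /mxtrace (bigD1 l) //=.
rewrite !mxE (bigD1 k) //= !mxE !eqxx mul1r !big1 ?addr0 // => i ne_i.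
  by rewrite !mxE big1 // => j _; rewrite !mxE (negPf ne_i) mul0r.
by rewrite !mxE (negPf ne_i) andbF mul0r.
Qed.

Variables (I : finType) (m n : I -> nat).

Lemma pairing_nondegenerate (D : forall i, 'M[R]_(m i, n i)) i :
  D i != 0 -> forall b, exists w : forall i, 'M[R]_(n i, m i),
    top_coef (\sum_i \tr (w i *m D i)) = b.
Proof.
move=> nzD b.
have [[k l] /= nzDkl] : exists kl, D i kl.1 kl.2 != 0.
  apply: contrapT => D0; case/eqP: nzD; apply/matrixP => k l; rewrite mxE.
  by apply/eqP; apply: contrapT => /negP Dkl; case: D0; exists (k, l).
have [s nz_s] := top_coef_nondegenerate nzDkl.
pose c := tconst a (b / top_coef (D i k l * s)) * s.
exists (fun j => if i == j then conform_mx 0 (c *: delta_mx l k) else 0).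
rewrite (bigD1 i) //= eqxx conform_mx_id mxtrace_delta_mul big1.
  by rewrite addr0 -mulrA top_coef_constM [s * _]mulrC divfK.
by move=> j /negPf; rewrite eq_sym => ->; rewrite mul0mx mxtrace0.
Qed.

(** A linear form attached to D takes every value equally often unless D = 0. *)
Lemma sum_nontriv_chars_pairing (D : forall i, 'M[R]_(m i, n i)) e :
  \sum_(g : {dffun forall i, 'M[R]_(n i, m i)})
     nontriv_chars (top_coef (\sum_i \tr (g i *m D i)) + e)
  = if [forall i, D i == 0]
    then #|{dffun forall i, 'M[R]_(n i, m i)}|%:Z * nontriv_chars e else 0.
Proof.
case: ifPn => [/forallP D0 | ].
  rewrite -natz -sumr_const mulr_suml; apply: eq_bigr => g _.
  rewrite mul1r big1 ?raddf0 ?add0r // => i _.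
  by rewrite (eqP (D0 i)) mulmx0 mxtrace0.
rewrite negb_forall => /existsP[i /pairing_nondegenerate w_ex].
have [w wE] := choice w_ex.
pose shift b (g : {dffun forall i, 'M[R]_(n i, m i)}) :
  {dffun forall i, 'M[R]_(n i, m i)} := [ffun j => g j + w b j].
apply: (@sum_equidistributed _ _ shift) => [b g g' eq_g | b g].
  apply/ffunP => j; have /ffunP/(_ j) := eq_g.
  by rewrite !ffunE => /addIr.
rewrite [RHS]addrAC; congr (_ + _); rewrite -{2}(wE b) -raddfD -big_split /=.
by congr top_coef; apply: eq_bigr => j _; rewrite ffunE mulmxDl mxtraceD.
Qed.

End CharacterSums.

Section CountSolutions.
Variables (Q : quiver) (r : vertex Q -> nat) (F : finFieldType) (a : nat).
Notation R := (trunc_poly F a.+1).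
Notation gl := {dffun forall i : vertex Q, 'M[R]_(r i)}.
Notation corep := {dffun forall a : arrow Q, 'M[R]_(r (src a), r (tgt a))}.

Definition End (x : rep r R) : {set gl} :=
  [set g : gl | [forall b, g (tgt b) *m x b == x b *m g (src b)]].

Lemma EndP (x : rep r R) (g : gl) : reflect (endo x g) (g \in End x).
Proof. by rewrite inE; apply: (iffP forallP) => xg b; apply/eqP; exact: xg. Qed.

(** Sum nontriv_chars over all pairs (y, g) at the pairing of g with
    moment x y - c.  Summing over g first detects the solutions y; by
    [moment_trace], summing over y first detects the endomorphisms g. *)
Lemma card_moment_solutions (x : rep r R) (c : vertex Q -> R) :
  (forall g : gl, g \in End x -> top_coef (\sum_i \tr (g i *m (c i)%:M)) = 0) ->
  (#|[set y : corep | [forall i, moment_map x y i == (c i)%:M]]| * #|{: gl}|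
   = #|{: corep}| * #|End x|)%N.
Proof.
move=> c_orth; apply/eqP; rewrite -eqz_nat.
pose L (g : gl) := top_coef (\sum_i \tr (g i *m (c i)%:M)).
pose Y := [set y : corep | [forall i, moment_map x y i == (c i)%:M]].
pose S := \sum_(y : corep) \sum_(g : gl)
  nontriv_chars
    (top_coef (\sum_i \tr (g i *m (moment_map x y i - (c i)%:M))) + 0).
have sum_ind (T : finType) (A : {set T}) (e : int) :
    \sum_t (if t \in A then e else 0) = #|A|%:Z * e.
  by rewrite -big_mkcond sumr_const -mulr_natl natz.
have S1 : S = (#|Y| * #|{: gl}|)%N%:Z * nontriv_chars (0 : F).
  rewrite PoszM -mulrA -sum_ind; apply: eq_bigr => y _.
  rewrite sum_nontriv_chars_pairing inE.
  by rewrite (eq_forallb (fun i => subr_eq0 _ _)).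
have S2 : S = (#|{: corep}| * #|End x|)%N%:Z * nontriv_chars (0 : F).
  rewrite mulnC PoszM -mulrA -sum_ind.
  rewrite /S exchange_big; apply: eq_bigr => g _ /=.
  pose ad b := g (tgt b) *m x b - x b *m g (src b).
  have pairE (y : corep) :
      top_coef (\sum_i \tr (g i *m (moment_map x y i - (c i)%:M))) + 0
      = top_coef (\sum_b \tr (y b *m ad b)) + - L g.
    rewrite addr0 /L -raddfB; congr top_coef.
    have trB i : \tr (g i *m (moment_map x y i - (c i)%:M))
       = \tr (g i *m moment_map x y i) - \tr (g i *m (c i)%:M).
      by rewrite mulmxBr raddfB.
    rewrite (eq_bigr _ (fun i _ => trB i)) sumrB; congr (_ - _).
    rewrite [LHS](moment_trace x y g).
    by apply: eq_bigr => b _; rewrite mxtrace_mulC.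
  rewrite (eq_bigr _ (fun y _ => congr1 (@nontriv_chars F) (pairE y))).
  rewrite sum_nontriv_chars_pairing.
  have -> : [forall b, ad b == 0] = (g \in End x).
    by rewrite inE; apply: eq_forallb => b; rewrite subr_eq0.
  by case: ifP => // /c_orth Lg0; rewrite /L Lg0 oppr0.
by apply/eqP/(mulIf (nontriv_chars0_neq0 F)); rewrite -S1 -S2.
Qed.

End CountSolutions.

(** * Counting isomorphism classes *)

Section CountClasses.
Variables (Q : quiver) (r : vertex Q -> nat) (R : finComUnitRingType).
Notation gl := {dffun forall i : vertex Q, 'M[R]_(r i)}.

Implicit Types (x y z : rep r R) (g h : gl).

Lemma in_GLr g : (g \in GLr r R) = [forall i, g i \in unitmx].
Proof. by rewrite inE. Qed.

Definition isos (x y : rep r R) : {set gl} :=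
  [set g in GLr r R | [forall b, g (tgt b) *m x b == y b *m g (src b)]].

Lemma isosP x y g :
  reflect ((forall i, g i \in unitmx) /\
           forall b, g (tgt b) *m x b = y b *m g (src b))
          (g \in isos x y).
Proof.
rewrite inE inE; apply: (iffP andP) => [[/forallP ug /forallP xg]|[ug xg]].
  by split=> // b; apply/eqP/xg.
by split; apply/forallP => // b; apply/eqP/xg.
Qed.

Lemma iso_repP x y : reflect (exists g, g \in isos x y) (iso_rep x y).
Proof.
apply: (iffP existsP) => -[g].
  by move=> g_iso; exists g; rewrite inE.
by rewrite inE => g_iso; exists g.
Qed.

Definition comp_gl (h g : gl) : gl := [ffun i => h i *m g i].
Definition inv_gl (g : gl) : gl := [ffun i => invmx (g i)].

Lemma isos1 x : [ffun i => 1%:M] \in isos x x.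
Proof.
apply/isosP; split=> [i|b]; rewrite !ffunE ?unitmx1 //.
by rewrite mulmx1 mul1mx.
Qed.

Lemma isos_comp x y z h g :
  h \in isos y z -> g \in isos x y -> comp_gl h g \in isos x z.
Proof.
move=> /isosP[uh yz] /isosP[ug xy]; apply/isosP; split=> [i|b]; rewrite !ffunE.
  by rewrite unitmx_mul uh ug.
by rewrite -mulmxA xy mulmxA yz mulmxA.
Qed.

Lemma isos_inv x y g : g \in isos x y -> inv_gl g \in isos y x.
Proof.
move=> /isosP[ug xy]; apply/isosP; split=> [i|b]; rewrite !ffunE.
  by rewrite unitmx_inv ug.
by apply: (canLR (mulKmx (ug _))); rewrite mulmxA xy mulmxK.
Qed.

Lemma leq_card_isos x y z h : h \in isos y z -> (#|isos x y| <= #|isos x z|)%N.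
Proof.
move=> h_iso; have /isosP[uh _] := h_iso.
rewrite -(@card_imset _ _ (comp_gl h)).
  apply/subset_leq_card/subsetP => _ /imsetP[g g_iso ->].
  exact: isos_comp g_iso.
move=> g g' /ffunP eq_g; apply/ffunP => i; have := eq_g i.
by rewrite !ffunE => /(can_inj (mulKmx (uh i))).
Qed.

Lemma card_isos x y : iso_rep x y -> #|isos x x| = #|isos x y|.
Proof.
case/iso_repP => h h_iso; apply/eqP; rewrite eqn_leq (leq_card_isos _ h_iso).
exact: leq_card_isos (isos_inv h_iso).
Qed.

Lemma iso_rep_refl : reflexive (@iso_rep Q r R).
Proof. by move=> x; apply/iso_repP; exists [ffun i => 1%:M]; apply: isos1. Qed.

Lemma iso_rep_sym : symmetric (@iso_rep Q r R).
Proof.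
by move=> x y; apply/iso_repP/iso_repP => -[g /isos_inv]; exists (inv_gl g).
Qed.

Lemma iso_rep_trans : transitive (@iso_rep Q r R).
Proof.
move=> y x z /iso_repP[g xy] /iso_repP[h yz]; apply/iso_repP.
by exists (comp_gl h g); apply: isos_comp yz xy.
Qed.

(** Orbit counting: each g in GL(r) is an isomorphism onto x0 from exactly one
    representation, and for x isomorphic to x0 there are as many isomorphisms
    from x to x0 as automorphisms of x. *)
Lemma sum_card_aut_class (x0 : rep r R) :
  (\sum_(x | iso_rep x0 x) #|isos x x| = #|GLr r R|)%N.
Proof.
have cardE x : iso_rep x0 x ->
    #|isos x x| = (\sum_(g in GLr r R) (g \in isos x x0))%N.
  move=> x0x; rewrite (@card_isos x x0) 1?iso_rep_sym // -sum1_card.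
  rewrite big_mkcond [RHS]big_mkcond.
  apply: eq_bigr => g _; rewrite [g \in isos x x0]inE.
  by case: (g \in GLr r R) => //=; case: [forall b, _].
rewrite (eq_bigr _ cardE) exchange_big -sum1_card; apply: eq_bigr => g /=.
rewrite inE => /forallP ug.
pose x1 : rep r R := [ffun b => invmx (g (tgt b)) *m (x0 b *m g (src b))].
have g_iso : g \in isos x1 x0.
  by apply/isosP; split=> // b; rewrite ffunE mulKVmx.
rewrite (bigD1 x1) /=; last by rewrite iso_rep_sym; apply/iso_repP; exists g.
rewrite g_iso big1 ?addn0 // => x /andP[_ ne_x]; apply/eqP; rewrite eqb0.
apply: contra ne_x => /isosP[_ xg]; apply/eqP/ffunP => b.
by rewrite ffunE -xg mulKmx.
Qed.

Lemma sum_card_aut (S : {set rep r R}) :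
  (forall x y, iso_rep x y -> x \in S -> y \in S) ->
  (\sum_(x in S) #|isos x x|
   = #|equivalence_partition (@iso_rep Q r R) S| * #|GLr r R|)%N.
Proof.
move=> S_iso.
have iso_equiv : {in S & &, equivalence_rel (@iso_rep Q r R)}.
  move=> x y z _ _ _; split=> [|xy]; first exact: iso_rep_refl.
  by apply/idP/idP; apply: iso_rep_trans; rewrite // iso_rep_sym.
rewrite (set_partition_big _ (equivalence_partitionP iso_equiv)) /=.
rewrite -sum_nat_const.
apply: eq_bigr => _ /imsetP[x0 Sx0 ->]; rewrite -(sum_card_aut_class x0).
apply: eq_bigl => x; rewrite inE andbC; case x0x : (iso_rep x0 x) => //=.
exact: S_iso x0x Sx0.
Qed.

End CountClasses.

(** * Counting the moment fiber *)

Lemma card_mx_family (I : finType) (R : finType) (m n : I -> nat) :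
  #|{dffun forall i, 'M[R]_(m i, n i)}| = (#|R| ^ \sum_i m i * n i)%N.
Proof.
rewrite card_dep_ffun expn_sum -big_enum foldrE big_map.
by apply: eq_bigr => i _; rewrite card_mx.
Qed.

Section MomentFiber.
Variables (Q : quiver) (r : vertex Q -> nat) (lambda : vertex Q -> int).
Variables (F : finFieldType) (p : nat) (K : closedFieldType).
Variables (iota : {rmorphism F -> K}) (a : nat).
Notation R := (trunc_poly F a.+1).
Notation gl := {dffun forall i : vertex Q, 'M[R]_(r i)}.
Notation corep := {dffun forall a : arrow Q, 'M[R]_(r (src a), r (tgt a))}.
Notation res := (@residue F a).
Hypotheses (hr : indivisible r) (hlambda : generic lambda r).
Hypothesis hp : p \in [pchar F].
Hypothesis hchar : (\sum_(i : vertex Q) `|lambda i| * r i < p)%N.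

Lemma isos_End (x : rep r R) : isos x x = End x :&: GLr r R.
Proof. by apply/setP => g; rewrite !inE andbC. Qed.

Lemma scalar_sub_GLr (g : gl) c0 c :
  (forall i, char_poly (map_mx res (g i)) = ('X - c0%:P) ^+ r i) ->
  ([ffun i => g i - (tconst a c)%:M] \in GLr r R) = (c != c0).
Proof.
move=> chi_g; have [[i0 ri0] _] := hr.
have detE i : \det (map_mx res (g i - (tconst a c)%:M))
    = (-1) ^+ r i * (c - c0) ^+ r i.
  have -> : map_mx res (g i - (tconst a c)%:M) = - (c%:M - map_mx res (g i)).
    by rewrite map_mxB map_scalar_mx /= tconstK opprB.
  rewrite -scaleN1r detZ; congr (_ * _).
  have := congr1 (fun f => f.[c]) (chi_g i).
  rewrite /= hornerE hornerXsubC => <-.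
  rewrite /char_poly -[LHS]/(\det _) -horner_evalE -det_map_mx; congr (\det _).
  by apply/matrixP=> k l; rewrite !mxE /= /horner_eval !(hornerE, hornerMn).
rewrite in_GLr; apply/forallP/idP => [/(_ i0) | ne_c i].
  rewrite ffunE unitmx_residue unitmxE detE unitfE mulf_eq0 signr_eq0 /=.
  by rewrite expf_eq0 subr_eq0 lt0n ri0.
rewrite ffunE unitmx_residue unitmxE detE unitfE mulf_eq0 signr_eq0 /=.
by rewrite expf_eq0 subr_eq0 (negPf ne_c) andbF.
Qed.

(** Every endomorphism g has exactly one c in F for which g - c is not
    invertible.  When these pairs (g, c) are counted by c instead, translation
    by c turns each count into the number of non-automorphisms. *)
Lemma card_End_aut (x : rep r R) :
  abs_indecomposable iota x ->
  (#|End x| + #|F| * #|isos x x| = #|F| * #|End x|)%N.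
Proof.
move=> indec.
pose sub c (g : gl) : gl := [ffun i => g i - (tconst a c)%:M].
have sub_inj c : injective (sub c).
  move=> g g' /ffunP eq_g; apply/ffunP => i.
  by have := eq_g i; rewrite !ffunE => /addIr.
have sub_End c g : (sub c g \in End x) = (g \in End x).
  rewrite !inE; apply: eq_forallb => b; rewrite !ffunE mulmxBl mulmxBr.
  by rewrite mul_scalar_mx mul_mx_scalar (inj_eq (addIr _)).
have count c :
    (\sum_(g in End x) (sub c g \notin GLr r R) = #|End x :\: GLr r R|)%N.
  rewrite -sum1_card [RHS](reindex_inj (sub_inj c)).
  rewrite big_mkcond [RHS]big_mkcond /=.
  apply: eq_bigr => g _; rewrite in_setD sub_End andbC.
  by case: (g \in End x); case: (_ \in GLr r R).
have card_End : #|End x| = (#|F| * #|End x :\: GLr r R|)%N.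
  rewrite -sum_nat_const -(eq_bigr _ (fun c _ => count c)) exchange_big /=.
  rewrite -sum1_card; apply: eq_bigr => g /EndP xg.
  have [c0 chi_g] := abs_indecomposable_char_poly hr indec xg.
  rewrite (bigD1 c0) //= (scalar_sub_GLr c0 chi_g) eqxx big1 // => c ne_c.
  by rewrite (scalar_sub_GLr c chi_g) ne_c.
by rewrite {1}card_End isos_End -mulnDr addnC cardsID.
Qed.

(** The moment equation over x is solvable exactly when its right-hand side is
    orthogonal to the endomorphisms of x; by [top_coef_t_lambda] this is the
    condition below. *)
Definition End_orthogonal (x : rep r R) : bool :=
  [forall g in End x, \sum_i (lambda i)%:~R * \tr (map_mx res (g i)) == 0].

Lemma End_orthogonal_iso x y :
  iso_rep x y -> End_orthogonal x -> End_orthogonal y.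
Proof.
case/iso_repP => h /isosP[uh xy] /forall_inP orth.
apply/forall_inP => g /EndP yg.
pose g' : gl := [ffun i => invmx (h i) *m g i *m h i].
have /orth : g' \in End x.
  apply/EndP => b; rewrite !ffunE.
  rewrite -!mulmxA xy; apply: (canLR (mulKmx (uh _))).
  by rewrite !mulmxA xy mulmxK // -yg.
congr (_ == _); apply: eq_bigr => i _; congr (_ * _).
by rewrite !trace_map_mx ffunE mxtrace_mulC mulmxA mulmxV // mul1mx.
Qed.

Definition fiber_over (x : rep r R) : {set corep} :=
  [set y : corep |
    [forall i, moment_map x y i == (t_lambda lambda a F i)%:M]].

Lemma card_fiber_over (x : rep r R) : End_orthogonal x ->
  (#|fiber_over x| * #|{: gl}| = #|{: corep}| * #|End x|)%N.
Proof.
move=> /forall_inP orth; apply: card_moment_solutions => g /orth/eqP.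
by rewrite top_coef_t_lambda.
Qed.

Lemma fiber_over_abs_indecomposable (x : rep r R) y :
  y \in fiber_over x -> abs_indecomposable iota x.
Proof.
rewrite inE => /forallP xy.
apply: (moment_fiber_abs_indecomposable iota hr hlambda hp hchar).
by move=> i; apply: (eqP (xy i)).
Qed.

(** All eigenvalues of the residues of g equal some c, so the weighted trace is
    c times the pairing of lambda with r. *)
Lemma abs_indecomposable_orthogonal (x : rep r R) :
  abs_indecomposable iota x -> End_orthogonal x.
Proof.
move=> indec; apply/forall_inP => g /EndP xg.
have [c chi_g] := abs_indecomposable_char_poly hr indec xg.
have trE i : \tr (map_mx res (g i)) = c * (r i)%:R.
  have [r0|r_gt0] := posnP (r i).
    rewrite [in RHS]r0 mulr0 /mxtrace big1 // => k _.
    by have := ltn_ord k; rewrite {2}r0.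
  apply: oppr_inj; rewrite -char_poly_trace // chi_g.
  have -> : ('X - c%:P) ^+ r i = \prod_(z <- nseq (r i) c) ('X - z%:P).
    by rewrite big_nseq -Monoid.iteropE.
  have := @coefPn_prod_XsubC _ (nseq (r i) c); rewrite size_nseq => ->.
    by rewrite big_nseq -Monoid.iteropE /= mulr_natr.
  by rewrite -lt0n.
have [pair0 _] := hlambda.
rewrite (eq_bigr (fun i => c * (lambda i * (r i)%:Z)%:~R)).
  by rewrite -mulr_sumr -rmorph_sum -/(pairing lambda r) pair0 rmorph0 mulr0.
by move=> i _; rewrite trE rmorphM mulrCA.
Qed.

Lemma orthogonal_abs_indecomposable (x : rep r R) :
  End_orthogonal x -> abs_indecomposable iota x.
Proof.
move=> /card_fiber_over card_x.
have : (0 < #|fiber_over x|)%N.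
  rewrite lt0n; apply/eqP => card0; move: card_x.
  rewrite card0 mul0n => /esym/eqP.
  rewrite muln_eq0 => /orP[]; apply/negP; rewrite -lt0n; apply/card_gt0P.
    by exists [ffun=> 0].
  by exists [ffun=> 0]; apply/EndP => b; rewrite !ffunE mul0mx mulmx0.
by case/card_gt0P => y /fiber_over_abs_indecomposable.
Qed.

(** The sum over absolutely indecomposable x of |Y| |End x| / |gl|, in which
    |End x| is q / (q - 1) times |Aut x| and the automorphism groups are summed
    class by class. *)
Lemma card_moment_fiber :
  (#|moment_fiber r (t_lambda lambda a F)| * #|{: gl}| * #|F|.-1
   = #|{: corep}| * #|F| * num_abs_indec r iota a.+1 * #|GLr r R|)%N.
Proof.
rewrite -!mulnA -sum_card_aut; last first.
  move=> x y xy; rewrite !inE => /asboolP/abs_indecomposable_orthogonal orth.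
  exact/asboolP/orthogonal_abs_indecomposable/(End_orthogonal_iso xy).
set fib := moment_fiber r (t_lambda lambda a F).
have -> : #|fib| =
    (\sum_(x in [set x : rep r R | `[< abs_indecomposable iota x >]])
       #|fiber_over x|)%N.
  rewrite [RHS]big_mkcond -sum1_card.
  transitivity (\sum_(x : rep r R) \sum_(y | (x, y) \in fib) 1)%N.
    by rewrite pair_big_dep; apply: eq_bigl => -[].
  apply: eq_bigr => x _; rewrite inE.
  have -> : (\sum_(y | (x, y) \in fib) 1 = #|fiber_over x|)%N.
    by rewrite -sum1_card; apply: eq_bigl => y; rewrite !inE.
  case: asboolP => // indec; apply/eqP; rewrite cards_eq0.
  apply/eqP/setP => y; rewrite in_set0; apply/negP.
  by move/fiber_over_abs_indecomposable.
rewrite big_distrl !big_distrr /=; apply: eq_bigr => x.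
rewrite inE => /asboolP indec.
rewrite mulnA card_fiber_over ?abs_indecomposable_orthogonal // -!mulnA.
congr (_ * _)%N.
have := card_End_aut indec; have := ltnW (card_finNzRing_gt1 F).
case: #|F| => // q _ /=.
by rewrite [(q.+1 * #|End x|)%N]mulSn => /addnI ->; rewrite mulnC.
Qed.

End MomentFiber.

Theorem theorem1p0p3 (Q : quiver) (alpha : nat) (r : vertex Q -> nat)
    (lambda : vertex Q -> int)
    (F : finFieldType) (p : nat)
    (K : closedFieldType) (iota : {rmorphism F -> K})
    (halpha : (1 <= alpha)%N)
    (hr : indivisible r)
    (hlambda : generic lambda r)
    (hp : p \in [pchar F])
    (hchar : (\sum_(i : vertex Q) `|lambda i| * r i < p)%N)
    (hK : integralRange iota) :
  let q : rat := #|F|%:R in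
  let t_lambda := fun i : vertex Q =>
    trunc_t F alpha ^+ alpha.-1 * (lambda i)%:~R in
  #|moment_fiber r t_lambda|%:R / #|GLr r (trunc_poly F alpha)|%:R
  = q ^ (- (alpha%:Z * euler_form r r))
    * ((num_abs_indec r iota alpha)%:R / (1 - q^-1)) :> rat.
Proof.
case: alpha halpha => // a _ q /=.
have q_gt1 : (1 < #|F|)%N := card_finNzRing_gt1 _.
have nz_q : q != 0 by rewrite pnatr_eq0 -lt0n ltnW.
have nz_q1 : q - 1 != 0 by rewrite subr_eq0 pnatr_eq1 gtn_eqF.
have nz_GL : #|GLr r (trunc_poly F a.+1)|%:R != 0 :> rat.
  rewrite pnatr_eq0 -lt0n; apply/card_gt0P; exists [ffun i => 1%:M].
  by rewrite in_GLr; apply/forallP => i; rewrite ffunE unitmx1.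
pose A := (\sum_i r i * r i)%N.
pose B := (\sum_b r (src b) * r (tgt b))%N.
have eulerE : euler_form r r = A%:Z - B%:Z.
  by rewrite /euler_form /A /B !(raddf_sum Posz) /=.
have qE : q ^ (- (a.+1%:Z * euler_form r r))
    = q ^+ (a.+1 * B) / q ^+ (a.+1 * A).
  by rewrite eulerE mulrBr opprB expfzDr // -!PoszM -exprnN.
have := card_moment_fiber iota a hr hlambda hp hchar.
move/(congr1 (fun n => n%:R : rat)).
rewrite !card_mx_family card_trunc_poly -!expnM !natrM !natrX.
rewrite -subn1 natrB ?(ltnW q_gt1) // -/q -/A -/B => main.
rewrite qE; apply: (mulIf nz_GL); rewrite divfK //.
apply: (mulIf (expf_neq0 (a.+1 * A) nz_q)); apply: (mulIf nz_q1).
rewrite main; field.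
by rewrite nz_q nz_q1 expf_neq0.
Qed.
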